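(* Let $x\in\mathbb{C}$ with $\mathrm{Re}(x)>0$. Then $$\prod_{n=0}^{\infty}\left(\frac{n+x}{n+1}\right)^{(-1)^{n+1}}=\frac{\Gamma\left(\frac x2\right)}{\sqrt\pi\,\Gamma\left(\frac{x+1}{2}\right)}.$$
   Context: $\Gamma$ is the Euler gamma function. The infinite product is the limit of its partial products. *)

(* Defs.v *)
From HB Require Import structures.
From mathcomp Require Export all_boot all_order all_algebra.
From mathcomp Require Export complex.
From mathcomp Require Export all_classical all_reals all_analysis.

Set Implicit Arguments.
Unset Strict Implicit.
Unset Printing Implicit Defensive.

Export Order.TTheory GRing.Theory Num.Theory.
Export numFieldNormedType.Exports.

Global Open Scope classical_set_scope.
Global Open Scope ring_scope.
Global Open Scope complex_scope.

Definition cexp (R : realType) (z : R[i]) : R[i] :=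
  (expR (complex.Re z))%:C * (cos (complex.Im z) +i* sin (complex.Im z)).

(* [t ^ s] for a positive real base [t] and a complex exponent [s]
   (principal value, since [ln t] is real). *)
Definition cpowR (R : realType) (t : R) (s : R[i]) : R[i] := cexp (s * (ln t)%:C).

Definition Cintegral (R : realType) (D : set R) (f : R -> R[i]) : R[i] :=
  (\int[lebesgue_measure]_(t in D) complex.Re (f t))%R +i*
  (\int[lebesgue_measure]_(t in D) complex.Im (f t))%R.

(* Euler's integral of the second kind. It converges, and is the gamma
   function, exactly on the half-plane [0 < Re z]; elsewhere the value of
   [Gamma z] is meaningless (it is not the analytic continuation). *)
Definition Gamma (R : realType) (z : R[i]) : R[i] :=
  Cintegral `]0, +oo[ (fun t : R => cpowR t (z - 1) * (expR (- t))%:C).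

(* Main.v *)
Require Import Defs.
From mathcomp Require Import ring lra zify measurable_realfun.

Set Implicit Arguments.
Unset Strict Implicit.
Unset Printing Implicit Defensive.

(** The proof compares the product with Gauss's limit formula
    [Gamma z = lim m^z m! / (z (z + 1) ... (z + m))]. Write [x = 2 w]. Pairing
    consecutive factors, the product of the first [2 k] factors is the quotient
    of [prod_(j < k) (w + 1/2 + j) (1/2 + j)] by [prod_(j < k) (w + j) (1 + j)].
    Up to a factor tending to 1 it equals [E(w) / (E(1/2) E(w + 1/2))], where
    [E(z)] is the Gauss approximation of [Gamma z] ([alt_prod_gauss]); the
    powers [m^w], [m^(1/2)] and [m^(w + 1/2)] combine to [1 / m], and for
    [k = m + 1] the factorials that remain are [m * m!] and [k!], whose ratio
    tends to 1. Passing to the limit gives the theorem, as soon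
    as [E(1/2)] tends to [sqrt pi] and [Gamma (w + 1/2)] is nonzero.

    Both limits, that of [E(z)] and that of [E(1/2)], are instances of a single
    one ([cvg_Cintegral_expRN]): for [p >= 1], [Re w > 0] and [b^p = m],
    [[
      b^w m! p^m / prod_(j <= m) (w + p j)
        = int_0^b t^(w-1) (1 - t^p / m)^m dt --> int_0^oo t^(w-1) e^(-t^p) dt.
    ]]
    The equality ([has_Cintegral_beta]) is an induction on the exponent of
    [1 - t^p / b^p] that starts from the integral of [t^(w-1)]; the limit is
    dominated convergence. The case [p = 1] is Gauss's formula. The case [p = 2], [w = 1]
    is Wallis's formula, its right-hand side being the Gaussian integral.

    Finally [Gamma] has no zero on the half-plane [Re z > 0] because
    [|E(z)|] stays away from zero ([sqnorm_gauss_gamma_ge]): in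
    [E(z) = m^z / (z prod_(1 <= j <= m) (1 + z / j))] the modulus of the
    product is at most a constant times [m^(Re z)]. *)

(** * Integrals up to a singularity at 0 *)

Lemma continuous_FTC2_gt0 (R : realType) (f F : R -> R) (e a : R) :
  0 < e < a -> (forall t : R, 0 < t -> {for t, continuous f}) ->
  (forall t : R, 0 < t -> is_derive t 1 F (f t)) ->
  (\int[lebesgue_measure]_(t in `[e, a]) (f t)%:E = (F a - F e)%:E)%E.
Proof.
move=> /andP[e0 ea] cf dF.
have cF t : 0 < t -> {for t, continuous F}.
  move=> t0; apply: differentiable_continuous; apply/derivable1_diffP.
  by have [] := dF _ t0.
rewrite EFinB; apply: continuous_FTC2 => //.
- apply: continuous_in_subspaceT => t; rewrite inE/= in_itv/= => /andP[et _].
  by apply: cf; exact: lt_le_trans et.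
- split.
  + move=> t; rewrite in_itv/= => /andP[et _].
    by have [] := dF _ (lt_trans e0 et).
  + by apply: cvg_at_right_filter; exact: cF.
  + by apply: cvg_at_left_filter; apply: cF; exact: lt_trans ea.
- move=> t; rewrite in_itv/= => /andP[et _].
  by rewrite derive1E; have [] := dF _ (lt_trans e0 et).
Qed.

(** A nonnegative function with a singularity at 0 is integrable up to 0 when it
    has a nonnegative antiderivative: the integrals from [e] to [a] increase as
    [e] decreases to 0, and [F a - F e <= F a]. *)
Lemma integrable_ge0_antiderivative (R : realType) (f F : R -> R) (a : R) :
  0 < a -> measurable_fun setT f ->
  (forall t : R, 0 <= f t) -> (forall t : R, 0 < t -> {for t, continuous f}) ->
  (forall t : R, 0 < t -> is_derive t 1 F (f t)) -> (forall t : R, 0 < t -> 0 <= F t) ->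
  lebesgue_measure.-integrable `]0, a] (EFin \o f).
Proof.
move=> a0 mf f0 cf dF F0.
pose D (i : nat) := `[a / i.+2%:R, a]%classic.
have UD : `]0, a]%classic = \bigcup_i D i.
  apply/seteqP; split => t; rewrite /= in_itv/=.
    move=> /andP[t0 ta].
    have := archi_boundP (ltW (divr_gt0 a0 t0)).
    set n := Num.bound _ => nP; exists n => //; rewrite /D /= in_itv/= ta andbT.
    rewrite ler_pdivrMr// mulrC -ler_pdivrMr//.
    by apply: (le_trans (ltW nP)); rewrite ler_nat ltnW.
  move=> [i _]; rewrite /D/= in_itv/= => /andP[it ->]; rewrite andbT.
  by apply: lt_le_trans it; exact: divr_gt0.
apply/integrableP; split.
  by apply/measurable_EFinP; exact: measurable_funTS.
under eq_integral do rewrite /= ger0_norm//.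
rewrite UD.
have : (\int[lebesgue_measure]_(x in D i) (f x)%:E)%E @[i --> \oo] -->
    (\int[lebesgue_measure]_(x in \bigcup_i D i) (f x)%:E)%E.
  apply: ge0_nondecreasing_set_cvg_integral => //.
  - move=> m n mn; apply/subsetPset => t; rewrite /D/= !in_itv/= => /andP[mt ->].
    rewrite andbT; apply: le_trans mt.
    by rewrite ler_pM2l// lef_pV2 ?posrE// ler_nat.
  - by move=> i; exact: measurable_itv.
  - by move=> i; apply/measurable_EFinP; exact: measurable_funTS.
  - by move=> i t _; rewrite lee_fin.
move=> h; apply: (@le_lt_trans _ _ (F a)%:E); last exact: ltry.
have hl := cvg_lim (@ereal_hausdorff R) h.
rewrite -hl; apply: lime_le; first by apply/cvg_ex; eexists; exact: h.
apply: nearW => i.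
have e0 : 0 < a / i.+2%:R by exact: divr_gt0.
rewrite (@continuous_FTC2_gt0 _ _ F)//.
  by rewrite lee_fin gerBl F0.
by rewrite e0/= gtr_pMr// invf_lt1// ltr1n.
Qed.

(** Improper form of the fundamental theorem at the left end point 0, where [f]
    may blow up: [F e] minus the integral from 0 to [e] does not depend on
    [e], and both terms tend to 0. *)
Lemma FTC2_cvg0 (R : realType) (f F : R -> R) (a : R) :
  0 < a -> measurable_fun setT f ->
  lebesgue_measure.-integrable `]0, a] (EFin \o f) ->
  (forall t : R, 0 < t -> {for t, continuous f}) ->
  (forall t : R, 0 < t -> is_derive t 1 F (f t)) ->
  F t @[t --> 0^'+] --> 0 ->
  \int[lebesgue_measure]_(t in `]0, a]) f t = F a.
Proof.
move=> a0 mf intf cf dF F0.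
have intf' : lebesgue_measure.-integrable `[0, a] (EFin \o f).
  have mf0 : measurable_fun `[0, a] (EFin \o f).
    by apply/measurable_EFinP; exact: measurable_funTS.
  have := @negligible_integrable _ (measurableTypeR R) R lebesgue_measure _ _ _
    (measurable_set1 0) (measurable_itv `[0, a]) mf0 (lebesgue_measure_set1 0).
  suff -> : `[0, a]%classic `\ (0 : R) = `]0, a]%classic by case=> _; apply.
  apply/seteqP; split => t /=; rewrite !in_itv/=.
    by move=> [/andP[t0 ->] /eqP tn0]; rewrite lt_neqAle t0 eq_sym tn0.
  by move=> /andP[t0 ->]; rewrite ltW//; split => //; apply/eqP; rewrite gt_eqF.
pose I e := \int[lebesgue_measure]_(t in `[0, e]) f t.
have I0 : I e @[e --> 0^'+] --> 0.
  apply: cvg_within_filter.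
  exact: (parameterized_integral_cvg_left a0 intf').
rewrite Rintegral_itv_obnd_cbnd//.
have : F e - I e @[e --> 0^'+] --> 0 - 0 by exact: cvgB.
rewrite subr0 => FI.
have FIE : \forall e \near 0^'+, 
    F e - I e = F a - \int[lebesgue_measure]_(t in `[0, a]) f t.
  near=> e; apply/esym.
  have e0 : 0 < e by [].
  have ea : e < a by near: e; exact: nbhs_right_lt.
  have := @Rintegral_itvB _ f (BLeft 0) (BRight a) e intf'.
  rewrite !bnd_simp => /(_ (ltW e0) (ltW ea)) /eqP.
  rewrite subr_eq => /eqP ->.
  have iea : lebesgue_measure.-integrable `[e, a] (EFin \o f).
    by apply: integrableS intf' => //; apply: subset_itvr; rewrite bnd_simp ltW.
  rewrite Rintegral_itv_obnd_cbnd//; last first.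
    by apply: integrableS iea => //; exact: subset_itv_oc_cc.
  rewrite {1}/Rintegral (@continuous_FTC2_gt0 _ _ F)// ?e0//= -/(I e).
  ring.
set J := F a - _ in FIE.
have h : (fun=> J) @ (0:R)^'+ --> (0 : R).
  exact: cvg_trans (near_eq_cvg FIE) FI.
have := cvg_lim (@norm_hausdorff _ R^o) h.
by rewrite lim_cst// => /(_ _)/eqP; rewrite subr_eq0 => /eqP ->.
Unshelve. all: by end_near. Qed.

(** * Real and imaginary parts of complex powers *)

(** The real part of [(c - i d) t^(s + i b)], for [t > 0]. The real and imaginary
    parts of complex multiples of complex powers are all of this form, and the
    family is stable under differentiation, so that complex powers can be
    differentiated and integrated with real analysis only. *)
Definition osc (R : realType) (s b c d t : R) : R :=
  expR (s * ln t) * (c * cos (b * ln t) + d * sin (b * ln t)).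

Lemma measurable_osc (R : realType) (s b c d : R) :
  measurable_fun setT (osc s b c d).
Proof.
have mln k : measurable_fun setT (fun t : R => k * ln t).
  by apply: measurable_funM => //; exact: measurable_ln.
apply: measurable_funM; first exact: measurableT_comp.
apply: measurable_funD; apply: measurable_funM => //.
- apply: measurableT_comp => //.
  by apply: continuous_measurable_fun; exact: continuous_cos.
- apply: measurableT_comp => //.
  by apply: continuous_measurable_fun; exact: continuous_sin.
Qed.

Lemma norm_osc_le (R : realType) (s b c d t : R) :
  `|osc s b c d t| <= expR (s * ln t) * (`|c| + `|d|).
Proof.
rewrite normrM ger0_norm ?expR_ge0// ler_wpM2l ?expR_ge0//.
rewrite (le_trans (ler_normD _ _))// lerD// normrM ler_piMr//.
  by rewrite ler_norml cos_geN1 cos_le1.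
by rewrite ler_norml sin_geN1 sin_le1.
Qed.

Lemma osc_cvg0 (R : realType) (s b c d : R) : 0 < s ->
  osc s b c d t @[t --> 0^'+] --> 0.
Proof.
move=> s0; apply/norm_cvg0P.
have h : (t `^ s * (`|c| + `|d|)) @[t --> 0^'+] --> 0 * (`|c| + `|d|).
  by apply: cvgMl; exact: powR_cvg0.
rewrite mul0r in h.
apply: (squeeze_cvgr _ _ h); last exact: cvg_cst.
near=> t; rewrite normr_ge0/= (le_trans (norm_osc_le _ _ _ _ _))//.
by rewrite /powR gt_eqF.
Unshelve. all: by end_near. Qed.

Lemma is_derive_osc (R : realType) (s b c d t : R) : 0 < t ->
  is_derive t 1 (osc s b c d) (osc (s - 1) b (s * c + b * d) (s * d - b * c) t).
Proof.
move=> t0; rewrite /osc.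
have dln := is_derive1_ln t0.
apply: is_derive_eq.
rewrite mulrBl mul1r expRD expRN lnK ?posrE//.
rewrite /GRing.scale/=; field.
by rewrite gt_eqF.
Qed.

Lemma continuous_osc (R : realType) (s b c d t : R) : 0 < t ->
  {for t, continuous (osc s b c d)}.
Proof.
move=> t0; apply: differentiable_continuous; apply/derivable1_diffP.
by have [] := is_derive_osc s b c d t0.
Qed.

(** The modulus of a complex power is the real power of exponent [Re], whose
    antiderivative [t^s / s] is nonnegative as [s > 0]. *)
Lemma integrable_osc (R : realType) (s b c d a : R) : 0 < s -> 0 < a ->
  lebesgue_measure.-integrable `]0, a] (EFin \o osc (s - 1) b c d).
Proof.
move=> s0 a0.
have oscE r t : osc r 0 1 0 t = expR (r * ln t) :> R.
  by rewrite /osc !mul0r cos0 addr0 !mulr1.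
have i1 : lebesgue_measure.-integrable `]0, a] (EFin \o osc (s - 1) 0 1 0).
  apply: (@integrable_ge0_antiderivative _ _ (osc s 0 s^-1 0)) => //.
  - exact: measurable_osc.
  - by move=> t; rewrite oscE expR_ge0.
  - by move=> t t0; exact: continuous_osc.
  - move=> t t0; apply: is_derive_eq; first exact: is_derive_osc.
    by rewrite mulfV ?gt_eqF// !mul0r mulr0 subr0 addr0.
  - move=> t t0; rewrite /osc !mul0r cos0 addr0 mulr1.
    by rewrite mulr_ge0 ?expR_ge0// invr_ge0 ltW.
apply: (le_integrable _ _ _ (integrableZl _ (`|c| + `|d|) i1)) => //.
  by apply/measurable_EFinP; apply: measurable_funTS; exact: measurable_osc.
move=> t _ /=; rewrite lee_fin oscE.
rewrite (le_trans (norm_osc_le _ _ _ _ _))// mulrC ler_norm//.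
Qed.

(** The new coefficients encode the division of [t^w] by [w = s + i b]. *)
Lemma Rintegral_osc (R : realType) (s b c d a : R) : 0 < s -> 0 < a ->
  \int[lebesgue_measure]_(t in `]0, a]) osc (s - 1) b c d t =
  osc s b ((s * c - b * d) / (s ^+ 2 + b ^+ 2))
          ((b * c + s * d) / (s ^+ 2 + b ^+ 2)) a.
Proof.
move=> s0 a0; apply: FTC2_cvg0 => //.
- exact: measurable_osc.
- exact: integrable_osc.
- by move=> t t0; exact: continuous_osc.
- move=> t t0; apply: is_derive_eq; first exact: is_derive_osc.
  have N0 : s ^+ 2 + b ^+ 2 != 0.
    by rewrite gt_eqF// ltr_wpDr ?sqr_ge0// exprn_gt0.
  by congr osc; field.
- exact: osc_cvg0.
Qed.

(** * Convergence of the truncated integrals *)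

(** The second factor bounds [(1 - t^p / m)^m] up to [t = m^(1/p)],
    for every [p >= 1] and [m >= 1]: this power is at most 1 near 0, and at most
    [e^(-t^p) <= e^(-t)] for [t >= 1]. One integrable function thus dominates all
    the integrands to which dominated convergence is applied. *)
Lemma expR_dominator (R : realType) (s : R) : 0 < s ->
  exists2 g : R -> R,
    lebesgue_measure.-integrable `]0, +oo[ (EFin \o g) &
    forall t, 0 < t ->
      expR ((s - 1) * ln t) * (if t <= 1 then 1 else expR (- t)) <= g t.
Proof.
move=> s0; pose k := `|s - 1| + 1.
have k0 : 0 < k by rewrite ltr_wpDl.
have ks : s - 1 <= k by rewrite (le_trans (ler_norm _))// lerDl.
pose C := 2 * expR (k * ln (2 * k)).
pose g1 := (fun t : R => expR ((s - 1) * ln t)) \_ `]0, 1].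
pose g2 t := C * exponential_pdf (2^-1) t.
have h2 : 0 < 2^-1 :> R by rewrite invr_gt0.
(* [g1] takes care of the singularity at 0 and [g2] of the tail *)
exists (g1 \+ g2).
  rewrite (_ : EFin \o _ = (EFin \o g1) \+ (EFin \o g2))%E//.
  apply: integrableD => //.
    rewrite -restrict_EFin; apply/integrable_restrict => //.
    have -> : `]0, +oo[ `&` `]0, 1] = `]0, (1:R)]%classic.
      by rewrite setIidr//; exact: subset_itvl.
    apply: eq_integrable (integrable_osc 0 1 0 s0 (@ltr01 R)) => //.
    by move=> t _ /=; rewrite /osc !mul0r cos0 addr0 !mulr1.
  rewrite (_ : EFin \o g2 = fun t => C%:E * (exponential_pdf 2^-1 t)%:E)%E//.
  apply: integrableZl => //.
  by apply: integrableS (integrable_exponential_pdf h2) => //; exact: measurable_itv.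
move=> t t0; rewrite /= /g1 /g2 patchE exponential_pdfE ?(ltW t0)//.
rewrite mem_setE in_itv/= t0/=; have [t1|t1] := leP t 1; first last.
  rewrite add0r.
  (* tangent line of ln at 2 k: it turns t^k into a multiple of e^(t/2) *)
  have tk : ln t <= t / (2 * k) - 1 + ln (2 * k).
    rewrite -lerBlDr -ln_div ?posrE ?mulr_gt0//.
    have : -1 < t / (2 * k) - 1 by rewrite ltrDr divr_gt0 ?mulr_gt0.
    by move/le_ln1Dx; rewrite addrC subrK.
  rewrite -expRD (_ : C * _ = expR (k * ln (2 * k) + - 2^-1 * t)); last first.
    by rewrite /C expRD; field.
  rewrite ler_expR.
  have lt0 : 0 <= ln t by rewrite ln_ge0// ltW.
  have : k * ln t <= k * (t / (2 * k) - 1 + ln (2 * k)) by rewrite ler_pM2l.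
  have -> : k * (t / (2 * k) - 1 + ln (2 * k)) = t / 2 - k + k * ln (2 * k).
    by field; rewrite gt_eqF.
  have : (s - 1) * ln t <= k * ln t by rewrite ler_wpM2r.
  lra.
by rewrite mulr1 lerDl mulr_ge0// ?mulr_ge0 ?expR_ge0// invr_ge0.
Qed.

(** With [u = y / m], the upper bound is [1 - u <= e^(-u)], and the lower one is
    [1 - u = (1 - u^2) / (1 + u) >= (1 - u^2) e^(-u)] followed by Bernoulli's
    inequality for [(1 - u^2)^m]. *)
Lemma expR_pow_bounds (R : realType) (y : R) (n : nat) :
  0 <= y <= n.+1%:R ->
  expR (- y) * (1 - y ^+ 2 / n.+1%:R) <= (1 - y / n.+1%:R) ^+ n.+1 <= expR (- y).
Proof.
move=> /andP[y0 yn]; set m := n.+1%:R.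
have m0 : 0 < m :> R by rewrite ltr0n.
have u0 : 0 <= y / m by rewrite divr_ge0// ltW.
have u1 : y / m <= 1 by rewrite ler_pdivrMr// mul1r.
have eE : expR (- y) = expR (- (y / m)) ^+ n.+1.
  by rewrite -expRM_natl -/m mulrN mulrCA mulfV ?mulr1// gt_eqF.
apply/andP; split; last first.
  by rewrite eE lerXn2r ?nnegrE ?subr_ge0 ?expR_ge0// expR_ge1Dx.
have h1 : expR (- (y / m)) * (1 - (y / m) ^+ 2) <= 1 - y / m.
  have -> : 1 - (y / m) ^+ 2 = (1 - y / m) * (1 + y / m) by ring.
  rewrite mulrCA ler_piMr ?subr_ge0// expRN ler_pdivrMl ?expR_gt0// mulr1.
  exact: expR_ge1Dx.
have bern x k : 0 <= x <= 1 -> 1 - x *+ k <= (1 - x) ^+ k :> R.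
  move=> /andP[x0 x1]; elim: k => [|k IH]; first by rewrite mulr0n subr0 expr0.
  rewrite exprS; apply: (@le_trans _ _ ((1 - x) * (1 - x *+ k))).
    rewrite mulrBl mul1r mulrBr mulr1 mulrS.
    have : 0 <= x * (x *+ k) by rewrite mulr_ge0// mulrn_wge0.
    lra.
  by rewrite ler_wpM2l// subr_ge0.
have u2 : 0 <= (y / m) ^+ 2 <= 1 by rewrite sqr_ge0 expr_le1.
apply: (@le_trans _ _ (expR (- y) * (1 - (y / m) ^+ 2) ^+ n.+1)).
  rewrite ler_wpM2l ?expR_ge0// (le_trans _ (bern _ n.+1 u2))//.
  rewrite -mulr_natr -/m le_eqVlt; apply/orP; left; apply/eqP.
  by field; rewrite gt_eqF.
rewrite eE -exprMn lerXn2r// nnegrE ?subr_ge0// mulr_ge0 ?expR_ge0// subr_ge0.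
by case/andP: u2.
Qed.

Lemma cvg_expR_pow (R : realType) (y : R) : 0 <= y ->
  (1 - y / n.+1%:R) ^+ n.+1 @[n --> \oo] --> expR (- y).
Proof.
move=> y0.
have h : expR (- y) * (1 - y ^+ 2 * n.+1%:R^-1) @[n --> \oo] --> expR (- y).
  rewrite -[X in _ --> X]mulr1 -[X in _ * X]subr0 -[X in _ - X](mulr0 (y ^+ 2)).
  apply: cvgMr; apply: cvgB; first exact: cvg_cst.
  by apply: cvgMr; exact: cvg_harmonic.
apply: (squeeze_cvgr _ h (cvg_cst _)); near=> n.
apply: expR_pow_bounds; rewrite y0/=.
apply: (@le_trans _ _ n%:R); last by rewrite ler_nat.
by near: n; exact: nbhs_infty_ger.
Unshelve. all: by end_near. Qed.

Lemma cvg_Rintegral_osc (R : realType) (s b c d : R) (p : nat) (a : nat -> R) :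
  0 < s -> (0 < p)%N -> `|c| + `|d| <= 1 ->
  (forall n, 0 < a n) -> (forall n, a n ^+ p = n.+1%:R) ->
  \int[lebesgue_measure]_(t in `]0, a n])
      (osc (s - 1) b c d t * (1 - t ^+ p / n.+1%:R) ^+ n.+1) @[n --> \oo] -->
  \int[lebesgue_measure]_(t in `]0, +oo[) (osc (s - 1) b c d t * expR (- t ^+ p)).
Proof.
move=> s0 p0 cd a0 ap.
pose f n t := osc (s - 1) b c d t * (1 - t ^+ p / n.+1%:R) ^+ n.+1.
pose h t := osc (s - 1) b c d t * expR (- t ^+ p).
have [g ig gP] := expR_dominator s0.
have mX : measurable_fun setT (fun t : R => t ^+ p).
  exact: measurable_funX.
have mf n : measurable_fun setT (f n).
  apply: measurable_funM; first exact: measurable_osc.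
  apply: measurable_funX; apply: measurable_funB => //.
  by apply: measurable_funM.
have mh : measurable_fun setT h.
  apply: measurable_funM; first exact: measurable_osc.
  by apply: measurableT_comp => //; exact: measurableT_comp.
have mD : measurable (`]0, +oo[%classic : set (measurableTypeR R)) by exact: measurable_itv.
have hfh t : 0 < t -> (f n \_ `]0, a n]) t @[n --> \oo] --> h t.
  move=> t0; have : f n t @[n --> \oo] --> h t.
    by apply: cvgMr; apply: cvg_expR_pow; rewrite exprn_ge0// ltW.
  apply: cvg_trans; apply: near_eq_cvg; near=> n.
  rewrite patchE mem_setE in_itv/= t0/= ifT//.
  rewrite -(@ler_pXn2r _ p)// ?nnegrE ?(ltW t0) ?(ltW (a0 _))// ap.
  apply: (@le_trans _ _ n%:R); last by rewrite ler_nat.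
  by near: n; exact: nbhs_infty_ger.
have hbd n t : 0 < t -> `|(f n \_ `]0, a n]) t| <= g t.
  move=> t0; have := gP t t0; apply: le_trans.
  rewrite patchE mem_setE in_itv/= t0/=.
  have pos : 0 <= expR ((s - 1) * ln t) * (if t <= 1 then 1 else expR (- t)).
    by rewrite mulr_ge0 ?expR_ge0//; case: ifP => // _; rewrite expR_ge0.
  case: ifPn => [ta|_]; last by rewrite normr0.
  have tan : 0 <= t ^+ p <= n.+1%:R.
    by rewrite exprn_ge0 ?(ltW t0)//= -ap ler_pXn2r// nnegrE ltW.
  have /andP[_ ub] := expR_pow_bounds tan.
  have lb : 0 <= 1 - t ^+ p / n.+1%:R.
    by rewrite subr_ge0 ler_pdivrMr ?mul1r ?ltr0n//; case/andP: tan.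
  rewrite normrM [X in _ * X]ger0_norm ?exprn_ge0// ler_pM// ?exprn_ge0//.
    rewrite (le_trans (norm_osc_le _ _ _ _ _))//.
    by rewrite ler_piMr ?expR_ge0.
  rewrite (le_trans ub)//; case: ifPn => [_|].
    by rewrite -expR0 ler_expR oppr_le0 exprn_ge0// ltW.
  rewrite -ltNge => t1; rewrite ler_expR lerN2.
  by rewrite -{1}[t]expr1 ler_weXn2l// ltW.
have mfn n : measurable_fun `](0:R), +oo[ (EFin \o (f n \_ `]0, a n])).
  apply/measurable_EFinP; apply: measurable_funTS.
  by apply/(measurable_restrictT _ _).1 => //; exact: measurable_funTS.
have [||||ih _ cv] := @dominated_convergence _ _ R lebesgue_measure _ mD
  (fun n => EFin \o (f n \_ `]0, a n])) (EFin \o h) (EFin \o g) mfn.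
- by apply/measurable_EFinP; exact: measurable_funTS.
- apply: aeW => t; rewrite /= in_itv/= andbT => t0.
  by apply/cvg_EFin; [exact: nearW|exact: hfh].
- exact: ig.
- apply: aeW => t n; rewrite /= in_itv/= andbT => t0.
  by rewrite lee_fin hbd.
have ih' := integrable_fin_num mD ih.
move: cv; rewrite -(fineK ih') => /fine_cvg.
apply: cvg_trans; apply: near_eq_cvg; apply: nearW => n /=.
rewrite -/(Rintegral _ _ _) -/(f n).
rewrite -Rintegral_mkcondr; congr (Rintegral _ _ _).
by rewrite setIidr//; exact: subset_itvl.
Unshelve. all: by end_near. Qed.

(** * Limits in the complex plane *)

(** The topology of [R[i]] comes from its norm, so convergence has to be derived
    from that of the two parts. *)
Lemma complex_cvg (R : realType) (u v : nat -> R) (a b : R) :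
  u n @[n --> \oo] --> a -> v n @[n --> \oo] --> b ->
  (u n +i* v n : R[i]^o) @[n --> \oo] --> (a +i* b : R[i]^o).
Proof.
move=> ua vb; apply/cvgrPdist_le => e e0.
have eR : e = (complex.Re e)%:C.
  by case: e e0 => x y; rewrite ltcE/= => /andP[/eqP-> _].
have e0' : 0 < complex.Re e / 2.
  by rewrite divr_gt0//; move: e0; rewrite ltcE => /andP[].
near=> n.
have -> : a +i* b - (u n +i* v n) = (a - u n)%:C + 'i * (b - v n)%:C.
  by apply/eqP; rewrite eq_complex /=; apply/andP; split; apply/eqP; ring.
have nC (z : R) : `|z%:C| = `|z|%:C.
  by rewrite normc_def /= expr0n/= addr0 sqrtr_sqr.
have n1 : `|'i%C : R[i]| = 1.
  by rewrite normc_def /= expr0n expr1n/= add0r sqrtr1.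
rewrite (le_trans (ler_normD _ _))// normrM n1 mul1r !nC eR -rmorphD lecR.
rewrite [leRHS](splitr (complex.Re e)) lerD//.
  by near: n; move/cvgrPdist_le : ua; apply.
by near: n; move/cvgrPdist_le : vb; apply.
Unshelve. all: by end_near. Qed.

Lemma cvg_realC (R : realType) (u : nat -> R) (a : R) :
  u n @[n --> \oo] --> a -> ((u n)%:C : R[i]^o) @[n --> \oo] --> (a%:C : R[i]^o).
Proof. by move=> ua; apply: complex_cvg => //; exact: cvg_cst. Qed.

Lemma cvg_even_odd (T : topologicalType) (u : nat -> T) (l : T) :
  u (2 * k)%N @[k --> \oo] --> l -> u (2 * k).+1 @[k --> \oo] --> l ->
  u n @[n --> \oo] --> l.
Proof.
move=> ue uo A Al.
have [Ne _ he] := ue _ Al; have [No _ ho] := uo _ Al.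
exists (2 * (Ne + No)).+1 => // n /= Nn.
have := odd_double_half n; rewrite -mul2n => nE.
rewrite -nE; move: nE; case: (odd n); rewrite ?add1n ?add0n => nE.
- apply: ho => /=; lia.
- apply: he => /=; lia.
Qed.

(** * Complex powers *)

Lemma Re_mul_real (R : realType) (z : R[i]) (r : R) :
  complex.Re (z * r%:C) = complex.Re z * r.
Proof. by case: z => a b /=; rewrite mulr0 subr0. Qed.

Lemma Im_mul_real (R : realType) (z : R[i]) (r : R) :
  complex.Im (z * r%:C) = complex.Im z * r.
Proof. by case: z => a b /=; rewrite mulr0 add0r. Qed.

Lemma cpowR_osc (R : realType) (t : R) (w : R[i]) :
  cpowR t w = osc (complex.Re w) (complex.Im w) 1 0 t +i*
              osc (complex.Re w) (complex.Im w) 0 1 t.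
Proof.
rewrite /cpowR /cexp Re_mul_real Im_mul_real /osc.
by apply/eqP; rewrite eq_complex /=; apply/andP; split; apply/eqP; ring.
Qed.

Lemma cpowRD (R : realType) (t : R) (v w : R[i]) :
  cpowR t (v + w) = cpowR t v * cpowR t w.
Proof.
case: v w => a b [c d]; rewrite !cpowR_osc /osc/= !mulrDl expRD cosD sinD.
by apply/eqP; rewrite eq_complex /=; apply/andP; split; apply/eqP; ring.
Qed.

Lemma cpowR_natr (R : realType) (t : R) (n : nat) : 0 < t ->
  cpowR t n%:R = (t ^+ n)%:C.
Proof.
move=> t0; have -> : n%:R = n%:R%:C :> R[i] by rewrite rmorph_nat.
rewrite cpowR_osc /osc /= !mul0r cos0 sin0 expRM_natl lnK ?posrE//.
by apply/eqP; rewrite eq_complex /=; apply/andP; split; apply/eqP; ring.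
Qed.

Lemma cpowR_neq0 (R : realType) (t : R) (w : R[i]) : cpowR t w != 0.
Proof.
apply/eqP => t0; have := cpowRD t w (- w).
rewrite t0 mul0r subrr /cpowR mul0r /cexp /= cos0 expR0.
by move=> /(congr1 (@complex.Re _))/eqP; rewrite /= mul0r subr0 mulr1 oner_eq0.
Qed.

(** * Beta-type integrals and their limit *)

(** [Cintegral] alone is not additive on functions that are not integrable, hence
    the integrability of both parts. *)
Definition has_Cintegral (R : realType) (D : set R) (f : R -> R[i]) (v : R[i]) :=
  [/\ lebesgue_measure.-integrable D (EFin \o (fun t => complex.Re (f t))),
      lebesgue_measure.-integrable D (EFin \o (fun t => complex.Im (f t))) &
      Cintegral D f = v].

Lemma has_CintegralB (R : realType) (D : set R) (f g : R -> R[i]) (r : R)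
    (u v : R[i]) : measurable D ->
  has_Cintegral D f u -> has_Cintegral D g v ->
  has_Cintegral D (fun t => f t - r%:C * g t) (u - r%:C * v).
Proof.
move=> mD [fR fI <-] [gR gI <-].
have RE t : complex.Re (f t - r%:C * g t) = complex.Re (f t) - r * complex.Re (g t).
  by case: (f t) (g t) => a b [c d] /=; ring.
have IE t : complex.Im (f t - r%:C * g t) = complex.Im (f t) - r * complex.Im (g t).
  by case: (f t) (g t) => a b [c d] /=; ring.
have iZ (h : R -> R) : lebesgue_measure.-integrable D (EFin \o h) ->
    lebesgue_measure.-integrable D (EFin \o (fun t => r * h t)).
  move=> ih; rewrite (_ : _ \o _ = fun t => r%:E * (h t)%:E)%E//.
  exact: integrableZl.
have iB (h k : R -> R) : lebesgue_measure.-integrable D (EFin \o h) ->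
    lebesgue_measure.-integrable D (EFin \o k) ->
    lebesgue_measure.-integrable D (EFin \o (fun t => h t - k t)).
  move=> ih ik.
  rewrite (_ : _ \o _ = (EFin \o h) \- (EFin \o k))%E//.
  exact: integrableB.
split.
- under [X in _ \o X]eq_fun do rewrite RE.
  by apply: iB => //; exact: iZ.
- under [X in _ \o X]eq_fun do rewrite IE.
  by apply: iB => //; exact: iZ.
- rewrite /Cintegral.
  under eq_Rintegral do rewrite RE.
  under [X in _ +i* X]eq_Rintegral do rewrite IE.
  rewrite !RintegralB// ?RintegralZl//; try exact: iZ.
  by apply/eqP; rewrite eq_complex /=; apply/andP; split; apply/eqP; ring.
Qed.

Lemma eq_has_Cintegral (R : realType) (D : set R) (f g : R -> R[i]) (v : R[i]) :
  measurable D -> {in D, f =1 g} -> has_Cintegral D f v -> has_Cintegral D g v.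
Proof.
move=> mD fg [fR fI <-]; split.
- by apply: eq_integrable fR => // t tD /=; rewrite fg.
- by apply: eq_integrable fI => // t tD /=; rewrite fg.
- by congr (_ +i* _); apply: eq_Rintegral => t tD; rewrite fg.
Qed.

Lemma has_Cintegral_cpowR (R : realType) (w : R[i]) (b : R) :
  0 < complex.Re w -> 0 < b ->
  has_Cintegral `]0, b] (fun t => cpowR t (w - 1)) (cpowR b w / w).
Proof.
case: w => s c /= s0 b0.
have E1 : (fun t => complex.Re (cpowR t (s +i* c - 1))) = osc (s - 1) c 1 0.
  by apply/funext => t; rewrite cpowR_osc /= oppr0 addr0.
have E2 : (fun t => complex.Im (cpowR t (s +i* c - 1))) = osc (s - 1) c 0 1.
  by apply/funext => t; rewrite cpowR_osc /= oppr0 addr0.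
split; rewrite ?E1 ?E2 ?/Cintegral.
- exact: integrable_osc.
- exact: integrable_osc.
- rewrite E1 E2 !Rintegral_osc// cpowR_osc/= /osc.
  have N0 : s ^+ 2 + c ^+ 2 != 0.
    by rewrite gt_eqF// ltr_wpDr ?sqr_ge0// exprn_gt0.
  by apply/eqP; rewrite eq_complex /=; apply/andP; split; apply/eqP; field.
Qed.

(** Induction on [k] for all [w] at once: writing one factor [1 - t^p / b^p] as a
    difference expresses the integral for [(k + 1, w)] through those for [(k, w)]
    and [(k, w + p)], and only [int_0^b t^(w-1) dt = b^w / w] has to be computed. *)
Lemma has_Cintegral_beta (R : realType) (p : nat) (b : R) (k : nat) (w : R[i]) :
  0 < complex.Re w -> 0 < b ->
  has_Cintegral `]0, b]
    (fun t => cpowR t (w - 1) * ((1 - t ^+ p / b ^+ p) ^+ k)%:C)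
    (cpowR b w * (k`!%:R * p%:R ^+ k) / \prod_(j < k.+1) (w + (p * j)%:R)).
Proof.
move=> + b0; elim: k w => [|k IH] w w0.
  rewrite big_ord1 muln0 addr0 fact0 expr0 !mulr1.
  apply: eq_has_Cintegral (has_Cintegral_cpowR w0 b0) => // t _.
  by rewrite expr0 mulr1.
have natRe n : 0 < complex.Re (w + n%:R).
  by rewrite raddfD /= -(rmorph_nat (real_complex R)) /= ltr_wpDr.
have nat_neq0 n : w + n%:R != 0.
  by apply/eqP => h; have := natRe n; rewrite h ltxx.
have := has_CintegralB ((b ^+ p)^-1) (measurable_itv `]0, b]) (IH w w0) (IH _ (natRe p)).
set A := (X in has_Cintegral _ _ X -> _).
set B := (X in _ -> has_Cintegral _ _ X).
have -> : A = B.
  rewrite {}/A {}/B cpowRD cpowR_natr// fmorphV.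
  have bp0 : (b ^+ p)%:C != 0 by rewrite fmorph_eq0 expf_neq0// gt_eqF.
  have P0 m : \prod_(j < m) (w + (p * j)%:R) != 0.
    by apply/prodf_neq0 => i _; exact: nat_neq0.
  (* shifting w by p removes the first factor of the product and adds a last one *)
  have PS : w * \prod_(j < k.+1) (w + p%:R + (p * j)%:R) =
      (\prod_(j < k.+1) (w + (p * j)%:R)) * (w + (p * k.+1)%:R).
    transitivity (\prod_(j < k.+2) (w + (p * j)%:R)); last first.
      by rewrite big_ord_recr.
    rewrite [RHS]big_ord_recl /= muln0 addr0; congr (_ * _); apply: eq_bigr => j _.
    by rewrite /bump /= mulnDr muln1 natrD addrA.
  have Q0 : \prod_(j < k.+1) (w + p%:R + (p * j)%:R) != 0.
    by apply/prodf_neq0 => i _; rewrite -addrA -natrD.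
  rewrite [in RHS]big_ord_recr /=.
  have w00 : w != 0 by rewrite -[w]addr0 (nat_neq0 0%N).
  have -> : \prod_(j < k.+1) (w + p%:R + (p * j)%:R) =
      (\prod_(j < k.+1) (w + (p * j)%:R)) * (w + (p * k.+1)%:R) / w.
    by rewrite -PS mulrAC mulfV ?mul1r.
  rewrite factS natrM exprS natrM.
  field.
  by rewrite nat1r -natrM nat_neq0 P0 w00 /=; exact: bp0.
apply: eq_has_Cintegral => // t; rewrite inE/= in_itv/= => /andP[t0 _].
rewrite [w + p%:R - 1]addrAC [cpowR t (w - 1 + p%:R)]cpowRD cpowR_natr//.
rewrite exprS; set X := (1 - _) ^+ k.
have -> : (1 - t ^+ p / b ^+ p) * X = X - (b ^+ p)^-1 * (t ^+ p * X) by ring.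
by rewrite rmorphB !rmorphM /=; ring.
Qed.

(** The left-hand side is the integral of [t^(w-1) (1 - t^p / m)^m] from 0
    to [m^(1/p)], where [m = n + 1]. *)
Lemma cvg_Cintegral_expRN (R : realType) (p : nat) (w : R[i]) (b : nat -> R) :
  0 < complex.Re w -> (0 < p)%N ->
  (forall n, 0 < b n) -> (forall n, b n ^+ p = n.+1%:R) ->
  (cpowR (b n) w * ((n.+1)`!%:R * p%:R ^+ n.+1) /
     \prod_(j < n.+2) (w + (p * j)%:R) : R[i]^o) @[n --> \oo] -->
  (Cintegral `]0, +oo[ (fun t => cpowR t (w - 1) * (expR (- t ^+ p))%:C) : R[i]^o).
Proof.
move=> w0 p0 b0 bp.
under eq_fun => n.
  have [_ _ <-] := has_Cintegral_beta p n.+1 w0 (b0 n).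
  rewrite /Cintegral bp.
  under eq_Rintegral do rewrite Re_mul_real.
  under [X in _ +i* X]eq_Rintegral do rewrite Im_mul_real.
  over.
rewrite /Cintegral.
under eq_Rintegral do rewrite Re_mul_real.
under [X in _ +i* X]eq_Rintegral do rewrite Im_mul_real.
have E1 t : complex.Re (cpowR t (w - 1)) =
    osc (complex.Re w - 1) (complex.Im w) 1 0 t.
  by rewrite cpowR_osc; case: (w) => s c /=; rewrite oppr0 addr0.
have E2 t : complex.Im (cpowR t (w - 1)) =
    osc (complex.Re w - 1) (complex.Im w) 0 1 t.
  by rewrite cpowR_osc; case: (w) => s c /=; rewrite oppr0 addr0.
apply: complex_cvg.
- under eq_fun do under eq_Rintegral do rewrite E1.
  under eq_Rintegral do rewrite E1.
  by apply: cvg_Rintegral_osc => //; rewrite normr1 normr0 addr0.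
- under eq_fun do under eq_Rintegral do rewrite E2.
  under eq_Rintegral do rewrite E2.
  by apply: cvg_Rintegral_osc => //; rewrite normr1 normr0 add0r.
Qed.

(** * Gauss's and Wallis's formulas *)

(** The [m]-th term of Gauss's limit formula, for [m = n + 1]. *)
Definition gauss_gamma (R : realType) (n : nat) (z : R[i]) : R[i] :=
  cpowR n.+1%:R z * (n.+1)`!%:R / \prod_(j < n.+2) (z + j%:R).

Lemma cvg_gauss_gamma (R : realType) (z : R[i]) : 0 < complex.Re z ->
  (gauss_gamma n z : R[i]^o) @[n --> \oo] --> (Gamma z : R[i]^o).
Proof.
move=> z0; have := @cvg_Cintegral_expRN R 1 z (fun n => n.+1%:R) z0 isT
  (fun n => ltr0Sn _ n) (fun n => expr1 _).
have -> : Cintegral `]0, +oo[ (fun t : R => cpowR t (z - 1) * (expR (- t ^+ 1))%:C)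
    = Gamma z.
  by [].
apply: cvg_trans; apply: near_eq_cvg; apply: nearW => n /=.
rewrite /gauss_gamma expr1n mulr1; congr (_ / _).
by apply: eq_bigr => j _; rewrite mul1n.
Qed.

(** The case [p = 2], [w = 1] of [cvg_Cintegral_expRN], with the Gaussian integral
    as its limit. As [prod_(j <= m) (1 + 2 j)] is [2^(m+1)] times the product of
    the [1/2 + j], twice this sequence is the Gauss approximation of
    [Gamma (1/2)]. *)
Lemma cvg_wallis (R : realType) :
  ((Num.sqrt n.+1%:R)%:C * ((n.+1)`!%:R * 2 ^+ n.+1) /
     \prod_(j < n.+2) (1 + (2 * j)%:R) : R[i]^o) @[n --> \oo] -->
  ((Num.sqrt (pi : R) / 2)%:C : R[i]^o).
Proof.
have b0 n : 0 < Num.sqrt (n.+1%:R : R) by rewrite sqrtr_gt0.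
have bp n : Num.sqrt n.+1%:R ^+ 2 = n.+1%:R :> R by rewrite sqr_sqrtr.
have one0 : 0 < complex.Re (1 : R[i]) by exact: ltr01.
have := @cvg_Cintegral_expRN R 2 1 _ one0 isT b0 bp.
have -> : Cintegral `]0, +oo[ (fun t : R => cpowR t (1 - 1) * (expR (- t ^+ 2))%:C)
    = (Num.sqrt pi / 2)%:C.
  have cp0 t : cpowR t (1 - 1) = 1 :> R[i].
    rewrite cpowR_osc subrr /osc /= !mul0r cos0 sin0 expR0 !mulr0 !mulr1.
    by rewrite !addr0 mulr0 mulr1.
  rewrite /Cintegral.
  under eq_Rintegral do rewrite cp0 mul1r /=.
  under [X in _ +i* X]eq_Rintegral do rewrite cp0 mul1r /=.
  congr (_ +i* _); last first.
    by rewrite /Rintegral integral0.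
  rewrite /Rintegral integral_itv_obnd_cbnd; last first.
    by apply/measurable_EFinP; apply: measurable_funTS; exact: measurable_gauss_fun.
  by rewrite integral0y_gauss.
apply: cvg_trans; apply: near_eq_cvg; apply: nearW => n /=.
by rewrite (@cpowR_natr R _ 1 (b0 n) : cpowR _ 1 = _) expr1.
Qed.

(** * The gamma function does not vanish *)

Definition sqnorm (R : realType) (z : R[i]) : R :=
  complex.Re z ^+ 2 + complex.Im z ^+ 2.

Lemma sqnormM (R : realType) (y z : R[i]) : sqnorm (y * z) = sqnorm y * sqnorm z.
Proof. by case: y z => a b [c d]; rewrite /sqnorm /=; ring. Qed.

Lemma sqnorm_cpowR (R : realType) (t : R) (z : R[i]) :
  sqnorm (cpowR t z) = expR (2 * complex.Re z * ln t).
Proof.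
rewrite cpowR_osc /osc /sqnorm /= !mul0r !mul1r addr0 add0r !exprMn -mulrDr.
by rewrite cos2Dsin2 mulr1 -expRM_natl mulrA.
Qed.

(** Each factor satisfies
    [|1 + z / j|^2 = 1 + (2 Re z / j + |z|^2 / j^2) <= exp (2 Re z / j + |z|^2 / j^2)],
    while the sum of the [1 / j] up to [m] is at most [1 + ln m] and that of the
    [1 / j^2] at most [2 - 1 / m]. *)
Lemma sqnorm_prod_le (R : realType) (z : R[i]) (n : nat) :
  0 < complex.Re z ->
  sqnorm (\prod_(j < n.+1) (1 + z / j.+1%:R)) <=
  expR (2 * complex.Re z * (1 + ln n.+1%:R) + sqnorm z * (2 - n.+1%:R^-1)).
Proof.
move=> s0.
have facE j : sqnorm (1 + z / j.+1%:R) =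
    1 + (2 * complex.Re z / j.+1%:R + sqnorm z / j.+1%:R ^+ 2).
  have j0 : j.+1%:R != 0 :> R by rewrite pnatr_eq0.
  have -> : z / j.+1%:R = z * (j.+1%:R^-1)%:C by rewrite fmorphV rmorph_nat.
  rewrite /sqnorm !raddfD /= Re_mul_real Im_mul_real.
  by field; rewrite nat1r pnatr_eq0.
elim: n => [|n IH].
  rewrite big_ord1 facE (le_trans (expR_ge1Dx _))// ler_expR ln1 invr1 expr1n.
  by rewrite divr1 addr0; lra.
rewrite big_ord_recr /= sqnormM facE.
apply: (le_trans (ler_pM _ _ IH (expR_ge1Dx _))).
- by rewrite addr_ge0 ?sqr_ge0.
- by rewrite -facE addr_ge0 ?sqr_ge0.
rewrite -expRD ler_expR.
set m : R := n.+1%:R; have -> : n.+2%:R = m + 1 :> R by rewrite /m natr1.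
have m0 : 0 < m by rewrite ltr0n.
have m1 : 0 < m + 1 by rewrite addr_gt0.
have q0 : 0 <= sqnorm z by rewrite addr_ge0 ?sqr_ge0.
(* the two telescoping bounds, for j = m + 1 *)
have lnm : (m + 1)^-1 <= ln (m + 1) - ln m.
  have : ln (1 - (m + 1)^-1) <= - (m + 1)^-1.
    by apply: le_ln1Dx; rewrite ltrN2 invf_lt1// ltrDr.
  have -> : 1 - (m + 1)^-1 = m / (m + 1) by field; rewrite gt_eqF.
  by rewrite ln_div ?posrE//; lra.
have inv2 : (m + 1) ^- 2 <= m^-1 - (m + 1)^-1.
  have -> : m^-1 - (m + 1)^-1 = (m * (m + 1))^-1.
    by field; rewrite !gt_eqF.
  by rewrite lef_pV2 ?posrE ?mulr_gt0// ?exprn_gt0// expr2 ler_pM2r// lerDl.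
have H1 : 2 * complex.Re z * (m + 1)^-1 <= 2 * complex.Re z * (ln (m + 1) - ln m).
  by rewrite ler_pM2l// mulr_gt0.
have H2 := ler_wpM2l q0 inv2.
move: H1 H2; rewrite -/m.
move: (complex.Re z) (sqnorm z) (ln m) (ln (m + 1)) (m^-1) ((m + 1)^-1)
  ((m + 1) ^- 2) => x q l l' i i' i2; nra.
Qed.

Lemma Re_gt0_natr_neq0 (R : realType) (z : R[i]) (n : nat) :
  0 < complex.Re z -> z + n%:R != 0.
Proof.
move=> s0; apply/eqP => /(congr1 (@complex.Re R)).
rewrite raddfD /= -(rmorph_nat (real_complex R)) /= => /eqP.
by rewrite gt_eqF// ltr_wpDr.
Qed.

(** A lower bound that does not depend on [n], which is what prevents the limit
    [Gamma z] from vanishing. *)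
Lemma sqnorm_gauss_gamma_ge (R : realType) (z : R[i]) (n : nat) :
  0 < complex.Re z ->
  expR (- (2 * complex.Re z + 2 * sqnorm z)) / sqnorm z <= sqnorm (gauss_gamma n z).
Proof.
move=> s0.
have q0 : 0 < sqnorm z by rewrite /sqnorm ltr_wpDr ?sqr_ge0 ?exprn_gt0.
set Q := \prod_(j < n.+1) (1 + z / j.+1%:R).
have z0 : z != 0 by rewrite -[z]addr0 (Re_gt0_natr_neq0 0).
have E : gauss_gamma n z * (z * Q) = cpowR n.+1%:R z.
  have -> : Q = (\prod_(j < n.+1) (z + j.+1%:R)) / (n.+1)`!%:R.
    rewrite /Q; elim: (n.+1) => [|k IH]; first by rewrite !big_ord0 fact0 divr1.
    rewrite !big_ord_recr /= IH factS natrM.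
    field.
    by rewrite nat1r !pnatr_eq0 -lt0n fact_gt0.
  rewrite /gauss_gamma big_ord_recl addr0.
  under [X in _ / (z * X)]eq_bigr do rewrite lift0.
  field.
  rewrite z0 pnatr_eq0 -lt0n fact_gt0 /=.
  by rewrite andbT; apply/prodf_neq0 => j _; exact: Re_gt0_natr_neq0.
have Qle := sqnorm_prod_le n s0.
have := congr1 (@sqnorm R) E; 
rewrite sqnorm_cpowR (sqnormM (gauss_gamma n z)) (sqnormM z) => E2.
have g0 : 0 <= sqnorm (gauss_gamma n z) by rewrite addr_ge0 ?sqr_ge0.
rewrite ler_pdivrMr// expRN -[_^-1]mulr1 ler_pdivrMl ?expR_gt0//.
set L := 2 * complex.Re z * ln n.+1%:R in E2.
rewrite -(ler_pM2l (expR_gt0 L)) mulr1 -{1}E2.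
set A := 2 * complex.Re z + _.
have -> : expR L * (expR A * (sqnorm (gauss_gamma n z) * sqnorm z)) =
    sqnorm (gauss_gamma n z) * (sqnorm z * expR (L + A)).
  by rewrite (expRD L A); ring.
rewrite ler_wpM2l// ler_wpM2l ?(ltW q0)// (le_trans Qle)// ler_expR /A /L.
have : 0 <= sqnorm z * n.+1%:R^-1 by rewrite mulr_ge0 ?(ltW q0).
move: (complex.Re z) (sqnorm z) (ln _) (_^-1) => x q l i; nra.
Qed.

Lemma Gamma_neq0 (R : realType) (z : R[i]) : 0 < complex.Re z -> Gamma z != 0.
Proof.
move=> s0; apply/eqP => G0.
have := cvg_gauss_gamma s0; rewrite G0.
set d := expR (- (2 * complex.Re z + 2 * sqnorm z)) / sqnorm z.
have q0 : 0 < sqnorm z by rewrite /sqnorm ltr_wpDr ?sqr_ge0 ?exprn_gt0.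
have d0 : 0 < d by rewrite divr_gt0 ?expR_gt0.
move=> /cvgr0Pnorm_lt /(_ (Num.sqrt d)%:C).
rewrite ltcR sqrtr_gt0 => /(_ d0) [n _ /(_ n (leqnn _))] /=.
rewrite normc_def ltcR ltNge => /negP; apply.
by rewrite ler_wsqrtr// sqnorm_gauss_gamma_ge.
Qed.

(** * Partial products *)

Definition alt_prod (R : realType) (x : R[i]) (N : nat) : R[i] :=
  \prod_(0 <= n < N) ((n%:R + x) / (n%:R + 1)) ^ ((-1) ^+ n.+1 : int).

Lemma alt_prod_odd (R : realType) (x : R[i]) (k : nat) :
  alt_prod x (2 * k).+1 =
  alt_prod x (2 * k) * (((2 * k)%:R + x) / ((2 * k)%:R + 1))^-1.
Proof.
rewrite /alt_prod big_nat_recr //=; congr (_ * _).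
by rewrite -signr_odd /= mul2n odd_double expr1 exprN1.
Qed.

Lemma alt_prod_even (R : realType) (w : R[i]) (k : nat) : 0 < complex.Re w ->
  alt_prod (2 * w) (2 * k) =
  (\prod_(j < k) (w + 2^-1 + j%:R)) * (\prod_(j < k) (1 + (2 * j)%:R)) /
  (2 ^+ k * k`!%:R * \prod_(j < k) (w + j%:R)).
Proof.
move=> w0; elim: k => [|k IH].
  by rewrite muln0 /alt_prod big_nil !big_ord0 fact0 expr0 !mulr1 divr1.
rewrite mulnS add2n /alt_prod big_nat_recr //= -/(alt_prod (2 * w) (2 * k).+1).
rewrite alt_prod_odd IH !big_ord_recr /= -signr_odd /= mul2n odd_double expr0.
rewrite expr1z factS natrM exprS -mul2n natrM -[(2 * k).+1%:R]natr1 natrM.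
have P0 : \prod_(j < k) (w + j%:R) != 0.
  by apply/prodf_neq0 => i _; exact: Re_gt0_natr_neq0.
have wk := Re_gt0_natr_neq0 k w0.
have f0 : k`!%:R != 0 :> R[i] by rewrite pnatr_eq0 -lt0n fact_gt0.
have k1 : 1 + k%:R != 0 :> R[i] by rewrite nat1r pnatr_eq0.
have k2 : 1 + 2 * k%:R != 0 :> R[i] by rewrite -natrM nat1r pnatr_eq0.
field.
rewrite wk P0 f0 k1 expf_neq0 ?pnatr_eq0// -mulrDr mulf_neq0 ?pnatr_eq0//.
  by rewrite -natrM !natr1 !pnatr_eq0.
by rewrite addrC.
Qed.

Lemma cpowR_half (R : realType) (t : R) : 0 < t -> cpowR t 2^-1 = (Num.sqrt t)%:C.
Proof.
move=> t0.
have -> : 2^-1 = (2^-1)%:C :> R[i] by rewrite fmorphV rmorph_nat.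
rewrite cpowR_osc /osc /= !mul0r cos0 sin0 !mulr0 !mulr1 !addr0 mulr1 mulr0.
by rewrite -powR12_sqrt ?(ltW t0)// /powR gt_eqF// .
Qed.

(** The factor [2 (...)] is the sequence of [cvg_wallis] doubled, in the role of the
    Gauss approximation of [Gamma (1/2)]. *)
Lemma alt_prod_gauss (R : realType) (w : R[i]) (n : nat) : 0 < complex.Re w ->
  alt_prod (2 * w) (2 * n.+2) =
  gauss_gamma n w /
  (2 * ((Num.sqrt n.+1%:R)%:C * ((n.+1)`!%:R * 2 ^+ n.+1) /
     \prod_(j < n.+2) (1 + (2 * j)%:R)) * gauss_gamma n (w + 2^-1)) *
  (n.+1%:R / n.+2%:R).
Proof.
move=> w0; rewrite alt_prod_even// /gauss_gamma cpowRD.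
have m0 : 0 < n.+1%:R :> R by rewrite ltr0n.
rewrite cpowR_half//.
have sE : n.+1%:R = (Num.sqrt n.+1%:R)%:C ^+ 2 :> R[i].
  by rewrite -rmorphXn /= sqr_sqrtr ?(ltW m0)// rmorph_nat.
have s0 : (Num.sqrt n.+1%:R)%:C != 0 :> R[i].
  by rewrite fmorph_eq0 gt_eqF// sqrtr_gt0.
rewrite [X in _ * (X / _)]sE [in LHS]factS [in LHS]natrM.
have c0 := cpowR_neq0 n.+1%:R w.
have P1 : \prod_(j < n.+2) (w + j%:R) != 0.
  by apply/prodf_neq0 => i _; exact: Re_gt0_natr_neq0.
have P2 : \prod_(j < n.+2) (w + 2^-1 + j%:R) != 0.
  apply/prodf_neq0 => i _; apply: Re_gt0_natr_neq0.
  have -> : 2^-1 = (2^-1)%:C :> R[i] by rewrite fmorphV rmorph_nat.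
  by rewrite raddfD /= addr_gt0.
have P3 : \prod_(j < n.+2) (1 + (2 * j)%:R) != 0 :> R[i].
  by apply/prodf_neq0 => i _; rewrite nat1r pnatr_eq0.
have f0 : (n.+1)`!%:R != 0 :> R[i] by rewrite pnatr_eq0 -lt0n fact_gt0.
have t0 : 2 ^+ n.+1 != 0 :> R[i] by rewrite expf_neq0// pnatr_eq0.
have n20 : n.+2%:R != 0 :> R[i] by rewrite pnatr_eq0.
rewrite exprS.
move: (cpowR _ _) (\prod_(j < n.+2) (w + j%:R)) (\prod_(j < n.+2) (w + 2^-1 + j%:R))
  (\prod_(j < n.+2) (1 + (2 * j)%:R)) (n.+1)`!%:R (2 ^+ n.+1) n.+2%:R
  (Num.sqrt n.+1%:R)%:C c0 P1 P2 P3 f0 t0 n20 s0 {sE}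
  => c q1 q2 q3 f t m s c0 P1 P2 P3 f0 t0 n20 s0.
field.
by rewrite n20 P2 P3 f0 s0 c0 t0 P1.
Qed.

Theorem corollary3p3 (R : realType) (x : R[i]) (hx : 0 < complex.Re x) :
  (\prod_(0 <= n < N) ((n%:R + x) / (n%:R + 1)) ^ ((-1) ^+ n.+1 : int) : R[i]^o)
    @[N --> \oo] -->
  (Gamma (x / 2) / ((Num.sqrt (pi : R))%:C * Gamma ((x + 1) / 2)) : R[i]^o).
Proof.
set l := (X in _ --> X).
pose w := x / 2.
have half : 2^-1 = (2^-1)%:C :> R[i] by rewrite fmorphV rmorph_nat.
have w0 : 0 < complex.Re w by rewrite /w half Re_mul_real divr_gt0.
have w20 : 0 < complex.Re (w + 2^-1) by rewrite half raddfD /= addr_gt0.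
have xE : x = 2 * w by rewrite /w mulrCA mulfV ?mulr1// pnatr_eq0.
have x1E : (x + 1) / 2 = w + 2^-1 by rewrite mulrDl mul1r.
have inv0 : ((n + 1).+1%:R^-1 : R) @[n --> \oo] --> (0 : R).
  have := @cvg_harmonic R; rewrite -(cvg_shiftn 1).
  by apply: cvg_trans; apply: near_eq_cvg; apply: nearW.
have even_cvg : (alt_prod x (2 * k) : R[i]^o) @[k --> \oo] --> (l : R[i]^o).
  rewrite -(cvg_shiftn 2) xE.
  under eq_fun do rewrite addn2 alt_prod_gauss//.
  rewrite -[l]mulr1; apply: cvgM.
    rewrite /l x1E -/w; apply: cvgM; first exact: cvg_gauss_gamma.
    have -> : (Num.sqrt pi)%:C = 2 * (Num.sqrt pi / 2)%:C :> R[i].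
      rewrite -(rmorph_nat (real_complex R)) -rmorphM /=; congr (_%:C).
      by field.
    apply: cvgV; last first.
      apply: cvgM; last exact: cvg_gauss_gamma.
      by apply: cvgMr; exact: cvg_wallis.
    rewrite !mulf_neq0 ?Gamma_neq0 ?pnatr_eq0// fmorph_eq0 gt_eqF//.
    by rewrite divr_gt0// sqrtr_gt0 pi_gt0.
  have : ((1 - (n + 1).+1%:R^-1 : R)%:C : R[i]^o) @[n --> \oo] --> ((1 - 0)%:C : R[i]^o).
    by apply: cvg_realC; apply: cvgB; [exact: cvg_cst|exact: inv0].
  rewrite subr0; apply: cvg_trans; apply: near_eq_cvg; apply: nearW => n /=.
  rewrite addn1 rmorphB fmorphV rmorph1 rmorph_nat /= -[n.+2%:R]natr1.
  by field; rewrite nat1r natr1 pnatr_eq0.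
(* an odd partial product has one more factor, which tends to 1 *)
apply: (cvg_even_odd even_cvg).
under eq_fun do rewrite -/(alt_prod x _) alt_prod_odd.
rewrite -[l]mulr1; apply: (cvgM even_cvg); rewrite -[X in _ --> X]invr1.
apply: cvgV; first exact: oner_neq0.
have inv2 : ((2 * k).+1%:R^-1 : R) @[k --> \oo] --> (0 : R).
  apply: (squeeze_cvgr _ (cvg_cst 0) (@cvg_harmonic R)); apply: nearW => k.
  by rewrite invr_ge0 ler0n /= lef_pV2 ?posrE// ler_nat ltnS leq_pmull.
have : (1 + (x - 1) * ((2 * k).+1%:R^-1)%:C : R[i]^o) @[k --> \oo] -->
    (1 + (x - 1) * (0 : R)%:C : R[i]^o).
  by apply: cvgD; [exact: cvg_cst|apply: cvgMr; exact: cvg_realC].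
rewrite mulr0 addr0; apply: cvg_trans; apply: near_eq_cvg; apply: nearW => k /=.
rewrite fmorphV rmorph_nat -[(2 * k).+1%:R]natr1.
by field; rewrite -natrM natr1 pnatr_eq0.
Qed.
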